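(* Let $\mathcal F_1=\{F\in\mathcal F \mid F=F_3(F)\}$, $v\mathcal F=\{F\in\mathcal F\mid hF=0,\ \omega(F)=0\}$ and $h\mathcal F=\{F\in\mathcal F\mid F_1(F)=F_2(F)=0\}$. Then $$\mathcal F=\mathcal F_1\oplus v\mathcal F\oplus h\mathcal F .$$ This decomposition is orthogonal and invariant under the action of $U(n)\times 1$. The components of $F\in\mathcal F$ in $\mathcal F_1$, $v\mathcal F$, $h\mathcal F$ are respectively $$F_3(F),\qquad F_1(F)+F_2(F)-2F_3(F),\qquad hF .$$
   Context: Let $n\ge 1$ and let $V$ be a $(2n+1)$-dimensional real vector space with an almost contact metric structure $(\varphi,\xi,\eta,g)$: $\varphi$ is an endomorphism of $V$, $\xi\in V$, $\eta\in V^*$, $g$ is a positive definite inner product, and for all $x,y\in V$: $\varphi^2x=-x+\eta(x)\xi$, $\varphi(\xi)=0$, $\eta\circ\varphi=0$, $g(\xi,\xi)=1$, $g(\varphi x,\varphi y)=g(x,y)-\eta(x)\eta(y)$. Put $hx=-\varphi^2x$. $\mathcal F$ is the subspace of $V^*\otimes V^*\otimes V^*$ of all trilinear forms $F$ with $F(x,y,z)=-F(x,z,y)=-F(x,\varphi y,\varphi z)+\eta(y)F(x,\xi,z)+\eta(z)F(x,y,\xi)$ for all $x,y,z\in V$. It carries the inner product $\langle F',F''\rangle=\sum_{i,j,k}F'(e_i,e_j,e_k)F''(e_i,e_j,e_k)$, where $\{e_i\}$ is an orthonormal basis of $V$. $U(n)\times 1$ denotes the group of linear automorphisms of $V$ preserving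 $(\varphi,\xi,\eta,g)$; it acts on $\mathcal F$ by $(aF)(x,y,z)=F(a^{-1}x,a^{-1}y,a^{-1}z)$. For $F\in\mathcal F$ define $\omega(F)(z)=F(\xi,\xi,z)$ and the following elements of $\mathcal F$ (the operators $F_i(\cdot)$ are distinct from the subspace denoted $\mathcal F_1$): $F_1(F)(x,y,z)=\eta(x)F(\xi,y,z)$; $F_2(F)(x,y,z)=\eta(y)F(x,\xi,z)-\eta(z)F(x,\xi,y)$; $F_3(F)(x,y,z)=\eta(x)\eta(y)F(\xi,\xi,z)-\eta(x)\eta(z)F(\xi,\xi,y)$; $hF(x,y,z)=F(hx,hy,hz)$. *)

(* Defs.v *)
From HB Require Import structures.
From mathcomp Require Import all_boot all_order all_algebra.
From mathcomp Require Import reals ring.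

Set Implicit Arguments.
Unset Strict Implicit.
Unset Printing Implicit Defensive.
Import Order.TTheory GRing.Theory Num.Theory.
Local Open Scope ring_scope.

Record almost_contact_metric (R : realType) (V : vectType R) :=
  AlmostContactMetric {
    acm_phi : 'End(V);
    acm_xi : V;
    acm_eta : 'Hom(V, R^o);
    acm_g : {dot V for @idfun R};
    acm_phi2 : forall x, acm_phi (acm_phi x) = - x + acm_eta x *: acm_xi;
    acm_phi_xi : acm_phi acm_xi = 0;
    acm_eta_phi : forall x, acm_eta (acm_phi x) = 0;
    acm_g_xi : acm_g acm_xi acm_xi = 1;
    acm_g_phi : forall x y, acm_g (acm_phi x) (acm_phi y) =
                            acm_g x y - acm_eta x * acm_eta y
  }.

(* V^* (x) V^* (x) V^*, as the vector space of curried trilinear forms *)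
Definition trilin (R : realType) (V : vectType R) : Type :=
  'Hom(V, 'Hom(V, 'Hom(V, R^o))).

HB.instance Definition _ (R : realType) (V : vectType R) :=
  Vector.copy (trilin V) 'Hom(V, 'Hom(V, 'Hom(V, R^o))).

Definition trilin_fun (R : realType) (V : vectType R) (F : trilin V)
  (x y z : V) : R := (F : 'Hom(V, 'Hom(V, 'Hom(V, R^o)))) x y z.
Coercion trilin_fun : trilin >-> Funclass.

Section Trilinear.
Variables (R : realType) (V : vectType R).

Definition trilinear (f : V -> V -> V -> R) : Prop :=
  [/\ forall a x x' y z, f (a *: x + x') y z = a * f x y z + f x' y z,
      forall a x y y' z, f x (a *: y + y') z = a * f x y z + f x y' z
    & forall a x y z z', f x y (a *: z + z') = a * f x y z + f x y z'].

(* [linfun] interpolates its argument on a basis, so [tri f] evaluates to f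
   only when f is trilinear; see [triE]. *)
Definition tri (f : V -> V -> V -> R) : trilin V :=
  linfun (fun x => linfun (fun y => linfun (f x y : V -> R^o))).

Lemma linfunE (W : vectType R) (f : V -> W) :
  linear f -> linfun f =1 f.
Proof.
move=> lf; pose L : {linear V -> W} :=
  HB.pack f (GRing.isLinear.Build _ _ _ _ f lf).
exact: (lfunE L).
Qed.

Lemma triE (f : V -> V -> V -> R) x y z : trilinear f -> tri f x y z = f x y z.
Proof.
case=> f1 f2 f3.
have E3 x' y' : linfun (f x' y' : V -> R^o) =1 f x' y'.
  by apply: linfunE => a; apply: f3.
have E2 x' : linfun (fun y => linfun (f x' y : V -> R^o))
             =1 fun y => linfun (f x' y : V -> R^o).
  apply: linfunE => a u v; apply/lfunP=> w.
  by rewrite add_lfunE scale_lfunE !E3 f2.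
rewrite /trilin_fun /tri linfunE ?E2 ?E3 // => a u v; apply/lfunP=> w; apply/lfunP=> t.
by rewrite add_lfunE scale_lfunE !E2 add_lfunE scale_lfunE !E3 f1.
Qed.

Lemma trilinearP (F : trilin V) : trilinear (fun x y z => F x y z).
Proof.
rewrite /trilin_fun; split=> *; rewrite !linearP //=.
- by rewrite add_lfunE scale_lfunE add_lfunE scale_lfunE.
- by rewrite add_lfunE scale_lfunE.
Qed.

Lemma trilinP (F G : trilin V) :
  (forall x y z, F x y z = G x y z) <-> F = G.
Proof.
split=> [FG|-> //].
by apply/lfunP=> x; apply/lfunP=> y; apply/lfunP=> z; apply: FG.
Qed.

Lemma trilin0E x y z : (0 : trilin V) x y z = 0 :> R.
Proof. by rewrite /trilin_fun !zero_lfunE. Qed.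

Lemma trilinDE (F G : trilin V) x y z : (F + G : trilin V) x y z = F x y z + G x y z.
Proof. by rewrite /trilin_fun !add_lfunE. Qed.

Lemma trilinNE (F : trilin V) x y z : (- F : trilin V) x y z = - F x y z.
Proof. by rewrite /trilin_fun !opp_lfunE. Qed.

Lemma trilinZE a (F : trilin V) x y z : (a *: F : trilin V) x y z = a * F x y z.
Proof. by rewrite /trilin_fun !scale_lfunE. Qed.

Lemma lkerP (W : vectType R) (op : trilin V -> W) (F : trilin V) :
  linear op -> reflect (op F = 0) (F \in lker (linfun op)).
Proof.
move=> lop; pose L : {linear trilin V -> W} :=
  HB.pack op (GRing.isLinear.Build _ _ _ _ op lop).
by rewrite memv_ker (lfunE L); apply: eqP.
Qed.

Lemma tri_linear (op : trilin V -> V -> V -> V -> R) :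
    (forall F, trilinear (op F)) ->
    (forall a F G x y z,
       op (a *: F + G) x y z = a * op F x y z + op G x y z) ->
  linear (fun F => tri (op F)).
Proof.
move=> op3 lop a F G; apply/trilinP=> x y z.
by rewrite trilinDE trilinZE !triE.
Qed.

(* The sum does not depend on the orthonormal basis e, so the inner product is
   kept as a function of e. *)
Definition trilin_dot (e : seq V) (F G : trilin V) : R :=
  \sum_(x <- e) \sum_(y <- e) \sum_(z <- e) F x y z * G x y z.

End Trilinear.

Definition orthonormal_basis (R : realType) (V : vectType R)
    (g : {dot V for @idfun R}) (e : seq V) : bool :=
  basis_of fullv e && orthonormal g e.

Section Subspaces.
Variables (R : realType) (V : vectType R) (M : almost_contact_metric V).

Local Notation phi := (acm_phi M).
Local Notation xi := (acm_xi M).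
Local Notation eta := (acm_eta M).
Local Notation g := (acm_g M).
Implicit Types (F : trilin V) (x y z : V).

Definition acm_h (x : V) : V := - phi (phi x).

(* calF is the common kernel of the two defects of its defining identities;
   see [calFP]. *)
Definition skew_defect (F : trilin V) : trilin V :=
  tri (fun x y z => F x y z + F x z y).

Definition phi_defect (F : trilin V) : trilin V :=
  tri (fun x y z => F x y z -
    (- F x (phi y) (phi z) + eta y * F x xi z + eta z * F x y xi)).

Definition calF : {vspace trilin V} :=
  (lker (linfun skew_defect) :&: lker (linfun phi_defect))%VS.

Definition omega (F : trilin V) : 'Hom(V, R^o) :=
  (F : 'Hom(V, 'Hom(V, 'Hom(V, R^o)))) xi xi.

Definition op_F1 (F : trilin V) : trilin V :=
  tri (fun x y z => eta x * F xi y z).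

Definition op_F2 (F : trilin V) : trilin V :=
  tri (fun x y z => eta y * F x xi z - eta z * F x xi y).

Definition op_F3 (F : trilin V) : trilin V :=
  tri (fun x y z => eta x * eta y * F xi xi z - eta x * eta z * F xi xi y).

Definition op_h (F : trilin V) : trilin V :=
  tri (fun x y z => F (acm_h x) (acm_h y) (acm_h z)).

Definition calF1 : {vspace trilin V} :=
  (calF :&: lker (linfun (fun F => F - op_F3 F)))%VS.

Definition calvF : {vspace trilin V} :=
  (calF :&: (lker (linfun op_h) :&: lker (linfun omega)))%VS.

Definition calhF : {vspace trilin V} :=
  (calF :&: (lker (linfun op_F1) :&: lker (linfun op_F2)))%VS.

(* The group U(n) x 1; a trivial kernel makes an endomorphism of V bijective,
   with inverse a^-1%VF. *)
Definition acm_automorphism (a : 'End(V)) : Prop :=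
  [/\ lker a == 0%VS,
      forall x, a (phi x) = phi (a x),
      a xi = xi,
      forall x, eta (a x) = eta x
    & forall x y, g (a x) (a y) = g x y].

Definition trilin_act (a : 'End(V)) (F : trilin V) : trilin V :=
  tri (fun x y z => F (a^-1%VF x) (a^-1%VF y) (a^-1%VF z)).

Definition acm_invariant (W : {vspace trilin V}) : Prop :=
  forall a, acm_automorphism a -> forall F, F \in W -> trilin_act a F \in W.

Definition trilin_orthogonal (W W' : {vspace trilin V}) : Prop :=
  forall e, orthonormal_basis g e ->
  forall F F', F \in W -> F' \in W' -> trilin_dot e F F' = 0.

(* The [tri] and [linfun] encodings above are faithful: the operators have the
   intended values and the kernels are cut out by the intended equations. *)

Let Tl (F : trilin V) a x x' y z :
  F (a *: x + x') y z = a * F x y z + F x' y z :> R.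
Proof. by case: (trilinearP F). Qed.
Let Tm (F : trilin V) a x y y' z :
  F x (a *: y + y') z = a * F x y z + F x y' z :> R.
Proof. by case: (trilinearP F). Qed.
Let Tr (F : trilin V) a x y z z' :
  F x y (a *: z + z') = a * F x y z + F x y z' :> R.
Proof. by case: (trilinearP F). Qed.
Let TF a (F G : trilin V) x y z :
  (a *: F + G : trilin V) x y z = a * F x y z + G x y z :> R.
Proof. by rewrite trilinDE trilinZE. Qed.
Let etaL a x y : eta (a *: x + y) = a * eta x + eta y :> R.
Proof. by rewrite linearP. Qed.
Let phiL a x y : phi (a *: x + y) = a *: phi x + phi y.
Proof. by rewrite linearP. Qed.
Let hL a x y : acm_h (a *: x + y) = a *: acm_h x + acm_h y.
Proof. by rewrite /acm_h !phiL opprD scalerN. Qed.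

Let T := (etaL, phiL, hL, Tl, Tm, Tr, TF).

Let tri_skew F : trilinear (fun x y z => F x y z + F x z y).
Proof. by split=> *; rewrite !T; ring. Qed.
Let tri_phi F : trilinear (fun x y z => F x y z -
    (- F x (phi y) (phi z) + eta y * F x xi z + eta z * F x y xi)).
Proof. by split=> *; rewrite !T; ring. Qed.
Let tri_F1 F : trilinear (fun x y z => eta x * F xi y z).
Proof. by split=> *; rewrite !T; ring. Qed.
Let tri_F2 F : trilinear (fun x y z => eta y * F x xi z - eta z * F x xi y).
Proof. by split=> *; rewrite !T; ring. Qed.
Let tri_F3 F : trilinear (fun x y z =>
  eta x * eta y * F xi xi z - eta x * eta z * F xi xi y).
Proof. by split=> *; rewrite !T; ring. Qed.
Let tri_h F : trilinear (fun x y z => F (acm_h x) (acm_h y) (acm_h z)).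
Proof. by split=> *; rewrite !T. Qed.

Lemma op_F1E F x y z : op_F1 F x y z = eta x * F xi y z.
Proof. exact: triE. Qed.

Lemma op_F2E F x y z : op_F2 F x y z = eta y * F x xi z - eta z * F x xi y.
Proof. exact: triE. Qed.

Lemma op_F3E F x y z :
  op_F3 F x y z = eta x * eta y * F xi xi z - eta x * eta z * F xi xi y.
Proof. exact: triE. Qed.

Lemma op_hE F x y z : op_h F x y z = F (acm_h x) (acm_h y) (acm_h z).
Proof. exact: triE. Qed.

Lemma trilin_actE a F x y z :
  trilin_act a F x y z = F (a^-1%VF x) (a^-1%VF y) (a^-1%VF z).
Proof. by apply: triE; split=> *; rewrite linearP ?T. Qed.

Lemma calFP F :
  reflect (forall x y z, F x y z = - F x z y /\
    F x y z = - F x (phi y) (phi z) + eta y * F x xi z + eta z * F x y xi)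
  (F \in calF).
Proof.
rewrite memv_cap; apply: (iffP andP) => [[/lkerP sF /lkerP pF] x y z|eqF].
  split; apply/eqP.
    rewrite -addr_eq0 -(triE _ _ _ (tri_skew F)) -/(skew_defect F) sF.
      by rewrite trilin0E.
    by apply: tri_linear => // *; rewrite !T; ring.
  rewrite -subr_eq0 -(triE _ _ _ (tri_phi F)) -/(phi_defect F) pF.
    by rewrite trilin0E.
  by apply: tri_linear => // *; rewrite !T; ring.
split; apply/lkerP; try by apply: tri_linear => // *; rewrite !T; ring.
  apply/trilinP=> x y z; rewrite trilin0E triE //.
  by case: (eqF x y z) => -> _; rewrite addNr.
apply/trilinP=> x y z; rewrite trilin0E triE //.
by case: (eqF x y z) => _ <-; rewrite subrr.
Qed.

Lemma calF1P F : reflect (F \in calF /\ F = op_F3 F) (F \in calF1).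
Proof.
have lin : linear (fun F => F - op_F3 F).
  move=> a G H; apply/trilinP=> x y z.
  by rewrite !(trilinDE, trilinNE, trilinZE, op_F3E); ring.
rewrite [F \in calF1]memv_cap; apply: (iffP andP) => -[FF].
  by move/(lkerP _ lin)/eqP; rewrite subr_eq0 => /eqP.
by move=> eqF; split=> //; apply/(lkerP _ lin); rewrite -eqF subrr.
Qed.

Lemma calvFP F : reflect [/\ F \in calF, op_h F = 0 & omega F = 0] (F \in calvF).
Proof.
have linh : linear op_h by apply: tri_linear => // *; rewrite !T.
have lino : linear omega by move=> a G H; rewrite /omega !(add_lfunE, scale_lfunE).
rewrite [F \in calvF]memv_cap [F \in (lker (linfun op_h) :&: _)%VS]memv_cap.
by apply: (iffP and3P) => -[FF h o]; split=> //; apply/lkerP.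
Qed.

Lemma calhFP F : reflect [/\ F \in calF, op_F1 F = 0 & op_F2 F = 0] (F \in calhF).
Proof.
have lin1 : linear op_F1 by apply: tri_linear => // *; rewrite !T; ring.
have lin2 : linear op_F2 by apply: tri_linear => // *; rewrite !T; ring.
rewrite [F \in calhF]memv_cap [F \in (lker (linfun op_F1) :&: _)%VS]memv_cap.
by apply: (iffP and3P) => -[FF h o]; split=> //; apply/lkerP.
Qed.

End Subspaces.

(* Main.v *)
Require Import Defs.
From mathcomp Require Import all_boot all_order all_algebra.
From mathcomp Require Import reals ring.
Import GRing.Theory Num.Theory.
Local Open Scope ring_scope.

(** Since [eta xi = 1], the operators [op_F1] and [op_F2] are commuting
    idempotents, with product [op_F3]. Both preserve [calF], and on [calF] the
    operator [op_h] is [(1 - op_F1) (1 - op_F2)]: expand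
    [h x = x - eta x xi] in each slot and use skewness ([op_h_expand]). So the
    three operators of the proposition are the pairwise annihilating
    idempotents [F1 F2], [F1 (1 - F2) + (1 - F1) F2] and [(1 - F1) (1 - F2)],
    whose sum is 1; their images of [calF] are [calF1], [calvF] and [calhF].

    Orthogonality holds because [op_F1] and [op_F2] are self-adjoint on [calF]
    ([trilin_dot_F1_adj], [trilin_dot_F2_adj]): summing [eta x * f x] over an
    orthonormal basis evaluates the linear form [f] at [xi] ([sum_eta]), so both
    [<F1 F, G>] and [<F2 F, G>] become expressions symmetric in [F] and [G].
    Invariance holds because an automorphism and its inverse preserve [xi],
    [eta] and [phi], the only data from which the operators are built. *)

Section Decomposition.
Context {R : realType} {V : vectType R} (M : almost_contact_metric V).

Local Notation phi := (acm_phi M).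
Local Notation xi := (acm_xi M).
Local Notation eta := (acm_eta M).
Local Notation g := (acm_g M).
Implicit Types (F G : trilin V) (x y z : V) (e : seq V).

(** * The idempotents *)

Lemma eta_xi : eta xi = 1 :> R.
Proof.
have xi_neq0 : xi != 0.
  apply/eqP=> xi0; have /eqP := acm_g_xi M.
  by rewrite xi0 linear0l eq_sym oner_eq0.
have /eqP := acm_phi2 M xi.
rewrite acm_phi_xi linear0 eq_sym addrC subr_eq0 -subr_eq0.
rewrite -[X in _ - X]scale1r -scalerBl scaler_eq0 (negPf xi_neq0) orbF.
by rewrite subr_eq0 => /eqP.
Qed.

Lemma g_xi x : g xi x = eta x.
Proof.
have := acm_g_phi M xi x; rewrite acm_phi_xi linear0l eta_xi mul1r.
by move/eqP; rewrite eq_sym subr_eq0 => /eqP.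
Qed.

Lemma acm_hE x : acm_h M x = x - eta x *: xi.
Proof. by rewrite /acm_h acm_phi2 opprD opprK. Qed.

Lemma trilinBl F x x' y z : F (x - x') y z = F x y z - F x' y z :> R.
Proof.
by case: (trilinearP F) => Fl _ _; rewrite addrC -scaleN1r Fl mulN1r addrC.
Qed.

Lemma trilinBm F x y y' z : F x (y - y') z = F x y z - F x y' z :> R.
Proof.
by case: (trilinearP F) => _ Fm _; rewrite addrC -scaleN1r Fm mulN1r addrC.
Qed.

Lemma trilinBr F x y z z' : F x y (z - z') = F x y z - F x y z' :> R.
Proof.
by case: (trilinearP F) => _ _ Fr; rewrite addrC -scaleN1r Fr mulN1r addrC.
Qed.

Lemma trilinZl F a x y z : F (a *: x) y z = a * F x y z :> R.
Proof. by rewrite /trilin_fun linearZ /= !scale_lfunE. Qed.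

Lemma trilinZm F a x y z : F x (a *: y) z = a * F x y z :> R.
Proof. by rewrite /trilin_fun linearZ /= !scale_lfunE. Qed.

Lemma trilinZr F a x y z : F x y (a *: z) = a * F x y z :> R.
Proof. by rewrite /trilin_fun linearZ. Qed.

(** Evaluates both sides of an identity between forms built from the operators
    and leaves a polynomial identity in the values of the forms. The syntactic
    match keeps unification from unfolding the operators down to [linfun]. *)
Local Ltac trilin_eval :=
  repeat match goal with
  | |- context [@trilin_fun _ _ (?A + ?B)%R ?x ?y ?z] => rewrite (trilinDE A B x y z)
  | |- context [@trilin_fun _ _ (- ?A)%R ?x ?y ?z] => rewrite (trilinNE A x y z)
  | |- context [@trilin_fun _ _ (?a *: ?A)%R ?x ?y ?z] => rewrite (trilinZE a A x y z)
  | |- context [@trilin_fun _ _ 0%R ?x ?y ?z] => rewrite (trilin0E x y z)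
  | |- context [@trilin_fun _ _ (op_F1 M ?A) ?x ?y ?z] => rewrite (op_F1E M A x y z)
  | |- context [@trilin_fun _ _ (op_F2 M ?A) ?x ?y ?z] => rewrite (op_F2E M A x y z)
  | |- context [@trilin_fun _ _ (op_F3 M ?A) ?x ?y ?z] => rewrite (op_F3E M A x y z)
  end; rewrite ?eta_xi.

Local Ltac trilin_ring :=
  let x := fresh "x" in let y := fresh "y" in let z := fresh "z" in
  apply/trilinP=> x y z; trilin_eval; ring.

Lemma op_F1_F2 F : op_F1 M (op_F2 M F) = op_F3 M F.
Proof. by trilin_ring. Qed.

Lemma op_F2_F1 F : op_F2 M (op_F1 M F) = op_F3 M F.
Proof. by trilin_ring. Qed.

Lemma op_F1_F3 F : op_F1 M (op_F3 M F) = op_F3 M F.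
Proof. by trilin_ring. Qed.

Lemma op_F2_F3 F : op_F2 M (op_F3 M F) = op_F3 M F.
Proof. by trilin_ring. Qed.

Lemma op_F3_idem F : op_F3 M (op_F3 M F) = op_F3 M F.
Proof. by rewrite -[LHS]op_F1_F2 op_F2_F3 op_F1_F3. Qed.

Lemma op_F1_0 : op_F1 M 0 = 0.
Proof. by trilin_ring. Qed.

Lemma op_hD F G : op_h M (F + G) = op_h M F + op_h M G.
Proof. by apply/trilinP=> x y z; rewrite trilinDE !op_hE trilinDE. Qed.

Lemma calF_skew F x y z : F \in calF M -> F x y z = - F x z y.
Proof. by case/calFP/(_ x y z). Qed.

Lemma calF_xi_xi F x : F \in calF M -> F x xi xi = 0.
Proof.
move=> FF; have /eqP := calF_skew F x xi xi FF.
by rewrite -addr_eq0 -mulr2n mulrn_eq0 => /eqP.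
Qed.

(** The identity [h = (1 - F1) (1 - F2)] of operators on [calF]: replacing [x]
    by [h x] is [1 - F1], and replacing both [y] and [z] is [1 - F2], as the
    [F x xi xi] terms vanish and skewness moves the remaining [xi] to the second
    slot. *)
Lemma op_h_expand F :
  F \in calF M -> op_h M F = F - op_F1 M F - op_F2 M F + op_F3 M F.
Proof.
move=> FF; apply/trilinP=> x y z.
rewrite op_hE !acm_hE !(trilinBl, trilinBm, trilinBr).
rewrite !(trilinZl, trilinZm, trilinZr).
trilin_eval; rewrite !calF_xi_xi // (calF_skew _ x y xi) //.
by rewrite (calF_skew _ xi y xi) //; ring.
Qed.

Lemma op_F1_calF F : F \in calF M -> op_F1 M F \in calF M.
Proof.
move=> /calFP FF; apply/calFP=> x y z; trilin_eval.
have [skF phF] := FF xi y z; split; first by rewrite skF; ring.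
by rewrite {1}phF; ring.
Qed.

(** The two [eta] terms of the defining identity reproduce [op_F2 F] and the
    [phi] term vanishes since [eta \o phi = 0]. *)
Lemma op_F2_calF F : op_F2 M F \in calF M.
Proof.
apply/calFP=> x y z; trilin_eval; rewrite !acm_eta_phi.
by split; ring.
Qed.

Lemma op_F3_calF F : F \in calF M -> op_F3 M F \in calF M.
Proof. by move=> FF; rewrite -op_F2_F1 op_F2_calF. Qed.

Lemma op_h_calF F : F \in calF M -> op_h M F \in calF M.
Proof.
by move=> FF; rewrite op_h_expand // rpredD ?rpredB ?op_F1_calF ?op_F2_calF
  ?op_F3_calF.
Qed.

(** * The three subspaces and the components *)

(** [omega F] is the restriction of [op_F3 F] to [x = y = xi], and determines
    it. *)
Lemma omega_eq0 F : F \in calF M -> omega M F = 0 <-> op_F3 M F = 0.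
Proof.
move=> FF; have omE z : omega M F z = F xi xi z by [].
split=> F0.
  apply/trilinP=> x y z; rewrite op_F3E trilin0E -!omE F0.
  by rewrite !zero_lfunE !mulr0 subr0.
apply/lfunP=> z; rewrite zero_lfunE omE.
have := op_F3E M F xi xi z; rewrite F0 trilin0E eta_xi calF_xi_xi //.
by rewrite mulr0 subr0 !mul1r.
Qed.

(** In terms of the idempotents, [calvF] is the common kernel of [F1 F2] and
    [(1 - F1) (1 - F2)]. *)
Lemma calvF_F3P F :
  reflect [/\ F \in calF M, op_h M F = 0 & op_F3 M F = 0] (F \in calvF M).
Proof.
by apply: (iffP (calvFP M F)) => -[FF hF /(omega_eq0 _ FF) oF].
Qed.

Lemma calvF_sum F : F \in calvF M -> F = op_F1 M F + op_F2 M F.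
Proof.
case/calvF_F3P=> FF hF F3; move/eqP: hF; rewrite op_h_expand // F3.
by rewrite addr0 -addrA -opprD subr_eq0 => /eqP.
Qed.

Lemma calhF_F3 F : F \in calhF M -> op_F3 M F = 0.
Proof. by case/calhFP=> _ _ F2; rewrite -op_F1_F2 F2 op_F1_0. Qed.

Lemma calhF_h F : F \in calhF M -> op_h M F = F.
Proof.
move=> hF; have [FF F1 F2] := calhFP M F hF.
by rewrite op_h_expand // F1 F2 (calhF_F3 _ hF) !subr0 addr0.
Qed.

Lemma calF1_h F : F \in calF1 M -> op_h M F = 0.
Proof.
case/calF1P=> FF F3; rewrite op_h_expand // F3.
by rewrite op_F1_F3 op_F2_F3 op_F3_idem subrr sub0r addNr.
Qed.

Lemma op_F3_calF1 F : F \in calF M -> op_F3 M F \in calF1 M.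
Proof. by move=> FF; apply/calF1P; rewrite op_F3_calF // op_F3_idem. Qed.

Lemma op_v_calvF F :
  F \in calF M -> op_F1 M F + op_F2 M F - 2 *: op_F3 M F \in calvF M.
Proof.
move=> FF; set G := _ - _.
have GF : G \in calF M.
  by rewrite rpredB ?rpredD ?rpredZ ?op_F1_calF ?op_F2_calF ?op_F3_calF.
apply/calvF_F3P; split=> //; first rewrite op_h_expand //.
all: by rewrite /G; trilin_ring.
Qed.

Lemma op_h_calhF F : F \in calF M -> op_h M F \in calhF M.
Proof.
move=> FF; apply/calhFP; split; first exact: op_h_calF.
all: by rewrite op_h_expand //; trilin_ring.
Qed.

Lemma component_sum F : F \in calF M ->
  F = op_F3 M F + (op_F1 M F + op_F2 M F - 2 *: op_F3 M F) + op_h M F.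
Proof.
move=> FF; rewrite op_h_expand //.
move: (op_F1 M F) (op_F2 M F) (op_F3 M F) => A B C.
trilin_ring.
Qed.

(** Directness comes from the operators: [op_F3] is the identity on [calF1] and
    0 on [calvF], while [op_h] kills both and is the identity on [calhF]. *)
Lemma calF_direct_sum :
  directv (calF1 M + calvF M + calhF M) /\
  calF M = (calF1 M + calvF M + calhF M)%VS.
Proof.
split.
  rewrite directv_addE directv_trivial; apply/andP; split.
    apply/directv_addP/eqP; rewrite -subv0; apply/subvP=> F.
    rewrite memv_cap memv0 => /andP[/calF1P[_ F3] /calvF_F3P[_ _ F30]].
    by rewrite F3 F30.
  rewrite /= -subv0; apply/subvP=> F; rewrite memv_cap memv0 => /andP[].
  case/memv_addP=> A A1 [B /calvF_F3P[_ hB _] ->] /calhF_h <-.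
  by rewrite op_hD (calF1_h _ A1) hB addr0.
apply/eqP; rewrite eqEsubv !subv_add !capvSl !andbT; apply/subvP=> F FF.
rewrite (component_sum F FF) !memv_add //.
- exact: op_F3_calF1.
- exact: op_v_calvF.
- exact: op_h_calhF.
Qed.

(** * Orthogonality *)

Section Orthogonality.
Variable e : seq V.
Hypothesis oe : orthonormal_basis g e.

Lemma orthonormal_dot : {in e &, forall x y, g x y = (x == y)%:R}.
Proof.
have /andP[_ /andP[]] := oe.
elim: e => //= v s IH /andP[/eqP v1 ns] /andP[]; rewrite andbT => /allP vs os.
have nv u : u \in s -> (v == u) = false.
  move=> us; apply/eqP=> vu; move: (vs u us); rewrite /= -vu v1.
  by rewrite oner_eq0.
move=> x y; rewrite !inE => /predU1P[->|xs] /predU1P[->|ys].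
- by rewrite eqxx v1.
- by rewrite nv //; apply/eqP/vs.
- by rewrite hermC mul1r /= eq_sym nv //; apply/eqP/vs.
- exact: IH.
Qed.

(** The coordinates of [xi] are the [g xi x], which are the [eta x]. *)
Lemma xi_sum : xi = \sum_(x <- e) eta x *: x.
Proof.
have /andP[be _] := oe; have ue := free_uniq (basis_free be).
have {1}-> := coord_basis (X := in_tuple e) be (memvf xi).
rewrite [RHS](big_nth 0) big_mkord; apply: eq_bigr => i _; congr (_ *: _).
rewrite -g_xi {2}(coord_basis (X := in_tuple e) be (memvf xi)).
rewrite linear_sumlz /= (bigD1 i) //= linearZl_LR /= orthonormal_dot ?mem_nth //.
rewrite eqxx mulr1 big1 ?addr0 // => j ji.
rewrite linearZl_LR /= orthonormal_dot ?mem_nth // nth_uniq //.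
by have /negPf -> : j != i :> nat := ji; rewrite mulr0.
Qed.

(** Used with [f] a form in one of its slots: contracting a slot with [eta] puts
    [xi] there. *)
Lemma sum_eta (f : V -> R) :
    (forall a x y, f (a *: x + y) = a * f x + f y) ->
  \sum_(x <- e) eta x * f x = f xi.
Proof.
move=> fL; rewrite [in RHS]xi_sum.
have f0 : f 0 = 0.
  have := fL 1 0 0; rewrite scale1r add0r mul1r => /eqP.
  by rewrite -subr_eq0 opprD addrA subrr sub0r oppr_eq0 => /eqP.
elim: e => [|x s IH]; first by rewrite !big_nil f0.
by rewrite !big_cons fL IH.
Qed.

Lemma trilin_dotC F G : trilin_dot e F G = trilin_dot e G F.
Proof.
by do 3!apply: eq_bigr => ? _; rewrite mulrC.
Qed.

Lemma trilin_dotDl F F' G :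
  trilin_dot e (F + F') G = trilin_dot e F G + trilin_dot e F' G.
Proof.
rewrite /trilin_dot; do 3!(rewrite -big_split; apply: eq_bigr => ? _).
by rewrite trilinDE mulrDl.
Qed.

Lemma trilin_dot0r F : trilin_dot e F 0 = 0.
Proof.
by rewrite /trilin_dot; do 3!(rewrite big1 // => ? _); rewrite trilin0E mulr0.
Qed.

Lemma trilin_dot_F1 F G : trilin_dot e (op_F1 M F) G =
  \sum_(y <- e) \sum_(z <- e) F xi y z * G xi y z.
Proof.
rewrite /trilin_dot exchange_big; apply: eq_bigr => y _.
rewrite exchange_big; apply: eq_bigr => z _.
under eq_bigr => x _ do rewrite op_F1E -mulrA.
apply: (sum_eta (fun x => F xi y z * G x y z)) => a x x'.
by case: (trilinearP G) => -> _ _; ring.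
Qed.

(** Skewness of [G] turns the second half of [op_F2 F] into a copy of the
    first, hence the factor 2. *)
Lemma trilin_dot_F2 F G : G \in calF M -> trilin_dot e (op_F2 M F) G =
  \sum_(x <- e) 2 * \sum_(z <- e) F x xi z * G x xi z.
Proof.
move=> GF; have [_ Gm Gr] := trilinearP G.
apply: eq_bigr => x _.
transitivity (\sum_(z <- e) \sum_(y <- e) eta y * (F x xi z * G x y z) -
              \sum_(y <- e) \sum_(z <- e) eta z * (F x xi y * G x y z)).
  rewrite [X in X - _]exchange_big -sumrB; apply: eq_bigr => y _.
  by rewrite -sumrB; apply: eq_bigr => z _; rewrite op_F2E; ring.
have at_xi_m z : \sum_(y <- e) eta y * (F x xi z * G x y z) =
    F x xi z * G x xi z.
  by apply: (sum_eta (fun y => F x xi z * G x y z)) => *; rewrite Gm; ring.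
have at_xi_r y : \sum_(z <- e) eta z * (F x xi y * G x y z) =
    - (F x xi y * G x xi y).
  rewrite -mulrN -calF_skew //.
  by apply: (sum_eta (fun z => F x xi y * G x y z)) => *; rewrite Gr; ring.
rewrite (eq_bigr _ (fun z _ => at_xi_m z)) (eq_bigr _ (fun y _ => at_xi_r y)).
by rewrite sumrN opprK mulr_natl mulr2n.
Qed.

Lemma trilin_dot_F1_adj F G :
  trilin_dot e (op_F1 M F) G = trilin_dot e F (op_F1 M G).
Proof.
rewrite (trilin_dotC F) !trilin_dot_F1.
by do 2!apply: eq_bigr => ? _; rewrite mulrC.
Qed.

Lemma trilin_dot_F2_adj F G : F \in calF M -> G \in calF M ->
  trilin_dot e (op_F2 M F) G = trilin_dot e F (op_F2 M G).
Proof.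
move=> FF GF; rewrite (trilin_dotC F) !trilin_dot_F2 //.
apply: eq_bigr => x _; congr (_ * _).
by apply: eq_bigr => z _; rewrite mulrC.
Qed.

(** [<F, G> = <F1 F2 F, G> = <F, F2 F1 G> = <F, F3 G>]. *)
Lemma trilin_dot_F3_eq0 F G : F \in calF1 M -> G \in calF M ->
  op_F3 M G = 0 -> trilin_dot e F G = 0.
Proof.
move=> /calF1P[FF ->] GF G0.
rewrite -op_F1_F2 trilin_dot_F1_adj trilin_dot_F2_adj ?op_F1_calF //.
by rewrite op_F2_F1 G0 trilin_dot0r.
Qed.

(** [<F, G> = <F1 F + F2 F, G> = <F, F1 G> + <F, F2 G>]. *)
Lemma trilin_dot_v_h F G : F \in calvF M -> G \in calhF M ->
  trilin_dot e F G = 0.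
Proof.
move=> vF /calhFP[GF G1 G2]; have /calvF_F3P[FF _ _] := vF.
rewrite (calvF_sum _ vF) trilin_dotDl trilin_dot_F1_adj trilin_dot_F2_adj //.
by rewrite G1 G2 !trilin_dot0r addr0.
Qed.

End Orthogonality.

Lemma calF1_orth_v : trilin_orthogonal M (calF1 M) (calvF M).
Proof.
by move=> e oe F G F1 /calvF_F3P[GF _ G3]; apply: trilin_dot_F3_eq0.
Qed.

Lemma calF1_orth_h : trilin_orthogonal M (calF1 M) (calhF M).
Proof.
move=> e oe F G F1 hG; have [GF _ _] := calhFP M G hG.
by apply: trilin_dot_F3_eq0 => //; apply: calhF_F3.
Qed.

Lemma calvF_orth_h : trilin_orthogonal M (calvF M) (calhF M).
Proof. by move=> e oe F G; apply: trilin_dot_v_h. Qed.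

(** * Invariance *)

Section Invariance.
Variable a : 'End(V).
Hypothesis aM : acm_automorphism M a.

Lemma acm_automorphism_inv :
  [/\ forall x, (a^-1)%VF (phi x) = phi ((a^-1)%VF x), (a^-1)%VF xi = xi
    & forall x, eta ((a^-1)%VF x) = eta x].
Proof.
have [ka aphi axi aeta _] := aM.
have injK := lker0_lfunK ka; have invK := lker0_lfunVK ka.
split=> [x||x].
- by rewrite -[RHS]injK aphi invK.
- by rewrite -[in LHS]axi injK.
- by rewrite -[in RHS](invK x) aeta.
Qed.

Lemma trilin_act0 : trilin_act a 0 = 0.
Proof. by apply/trilinP=> x y z; rewrite trilin_actE !trilin0E. Qed.

Lemma trilin_act_F1 F : op_F1 M (trilin_act a F) = trilin_act a (op_F1 M F).
Proof.
have [_ axi aeta] := acm_automorphism_inv.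
by apply/trilinP=> x y z; rewrite !(trilin_actE, op_F1E) axi aeta.
Qed.

Lemma trilin_act_F2 F : op_F2 M (trilin_act a F) = trilin_act a (op_F2 M F).
Proof.
have [_ axi aeta] := acm_automorphism_inv.
by apply/trilinP=> x y z; rewrite !(trilin_actE, op_F2E) axi !aeta.
Qed.

Lemma trilin_act_F3 F : op_F3 M (trilin_act a F) = trilin_act a (op_F3 M F).
Proof. by rewrite -!op_F1_F2 trilin_act_F2 trilin_act_F1. Qed.

Lemma trilin_act_h F : op_h M (trilin_act a F) = trilin_act a (op_h M F).
Proof.
have [aphi _ _] := acm_automorphism_inv.
apply/trilinP=> x y z; rewrite !(trilin_actE, op_hE) /acm_h !linearN /=.
by rewrite !aphi.
Qed.

Lemma trilin_act_calF F : F \in calF M -> trilin_act a F \in calF M.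
Proof.
have [aphi axi aeta] := acm_automorphism_inv.
move=> /calFP FF; apply/calFP=> x y z; rewrite !trilin_actE !aphi axi.
by rewrite -(aeta y) -(aeta z); apply: FF.
Qed.

End Invariance.

Lemma calF1_invariant : acm_invariant M (calF1 M).
Proof.
move=> a aM F /calF1P[FF F3]; apply/calF1P.
by rewrite trilin_act_calF // trilin_act_F3 // -F3.
Qed.

Lemma calvF_invariant : acm_invariant M (calvF M).
Proof.
move=> a aM F /calvF_F3P[FF hF F3]; apply/calvF_F3P.
by rewrite trilin_act_calF // trilin_act_h // trilin_act_F3 // hF F3 trilin_act0.
Qed.

Lemma calhF_invariant : acm_invariant M (calhF M).
Proof.
move=> a aM F /calhFP[FF F1 F2]; apply/calhFP.
by rewrite trilin_act_calF // trilin_act_F1 // trilin_act_F2 // F1 F2 trilin_act0.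
Qed.

End Decomposition.

Theorem proposition1 (R : realType) (n : nat) (hn : (1 <= n)%N)
    (V : vectType R) (dimV : \dim {:V} = (2 * n + 1)%N)
    (M : almost_contact_metric V) :
  [/\ directv (calF1 M + calvF M + calhF M) /\ calF M = (calF1 M + calvF M + calhF M)%VS,
      [/\ trilin_orthogonal M (calF1 M) (calvF M),
          trilin_orthogonal M (calF1 M) (calhF M)
        & trilin_orthogonal M (calvF M) (calhF M)],
      [/\ acm_invariant M (calF1 M),
          acm_invariant M (calvF M)
        & acm_invariant M (calhF M)]
    & forall F : trilin V, F \in calF M ->
      [/\ op_F3 M F \in calF1 M,
          op_F1 M F + op_F2 M F - 2 *: op_F3 M F \in calvF M,
          op_h M F \in calhF M
        & F = op_F3 M F + (op_F1 M F + op_F2 M F - 2 *: op_F3 M F)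
              + op_h M F]].
Proof.
split.
- exact: calF_direct_sum.
- by split; [exact: calF1_orth_v | exact: calF1_orth_h | exact: calvF_orth_h].
- by split; [exact: calF1_invariant | exact: calvF_invariant
            | exact: calhF_invariant].
- by move=> F FF; split; [exact: op_F3_calF1 | exact: op_v_calvF
    | exact: op_h_calhF | exact: component_sum].
Qed.
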